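(* There are universal constants $c,C,D>0$ such that for every positive integer $n$, every $0<\varepsilon<c/\sqrt n$ and every $d\ge D/\varepsilon^2$: if $\mathcal{S}$ is a distribution over $m\times d$ matrices having the $\varepsilon$-AMM property for $d\times n$ matrices, then $m\ge C/\varepsilon^2$.
   Context: A distribution $\mathcal{S}$ over $m\times d$ matrices has the $\varepsilon$-AMM property for $d\times n$ matrices if for every fixed $A\in\mathbb{R}^{d\times n}$, with probability at least a fixed constant close to $1$ (e.g. $9/10$) over $\mathbf{S}\sim\mathcal{S}$, $\|A^T\mathbf{S}^T\mathbf{S}A-A^TA\|_F\le\varepsilon\|A\|_F^2$. $\|\cdot\|_F$ is the Frobenius norm. *)

(* Defs.v *)
From HB Require Import structures.
From mathcomp Require Import all_boot all_order all_algebra.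
From mathcomp Require Import all_classical all_reals all_analysis.
Set Implicit Arguments.
Unset Strict Implicit.
Unset Printing Implicit Defensive.
Import Order.TTheory GRing.Theory Num.Theory.
Import numFieldNormedType.Exports.
Local Open Scope classical_set_scope.
Local Open Scope ring_scope.

(* The library norm on 'M[R]_(m, n) is the entrywise max norm, hence this
   separate definition. *)
Definition frobenius_norm (R : realType) (m n : nat) (A : 'M[R]_(m, n)) : R :=
  Num.sqrt (\sum_(i < m) \sum_(j < n) A i j ^+ 2).

(* 'M[R]_(m, d) with its Borel sigma-algebra; the topology on matrices is the
   product (entrywise) one, i.e., that of R^(m * d). *)
Definition borel_matrix (R : realType) (m d : nat) :
    measurableType (@open 'M[R]_(m, d)).-sigma :=
  g_sigma_algebraType (@open 'M[R]_(m, d)).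

(* The success probability, "a fixed constant close to 1", is taken to be 9/10.
   The event is closed, hence measurable. *)
Definition AMM (R : realType) (m d : nat) (n : nat) (eps : R)
    (P : probability (borel_matrix R m d) R) : Prop :=
  forall A : 'M[R]_(d, n),
    ((9 / 10)%:E <=
     P [set S : 'M[R]_(m, d) |
          (frobenius_norm (A^T *m S^T *m S *m A - A^T *m A)
             <= eps * frobenius_norm A ^+ 2)%R])%E.

(* Main.v *)
(** Padding a vector with zero columns turns the AMM property into the
    statement that every fixed vector [v] is rarely distorted: [|Sv|^2] is
    within [eps |v|^2] of [|v|^2] with probability at least 9/10.  Let
    [x, y] be independent uniform sign vectors supported on [p] coordinates,
    [p] of order [1 / eps^2].  By polarization, if neither [x + y] nor [x - y]
    is distorted then [|<(S^T S - 1) x, y>| <= eps p].  If [m] were at most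
    [p / 40], then [|(S^T S - 1) x|^2 >= p / 2] for 95% of the [x], because
    the component of [x] orthogonal to the row space of [S] is unaffected by
    [S^T S]; and for each such [x], Khintchine and Paley-Zygmund show that
    [<(S^T S - 1) x, y>] has size at least [sqrt (p / 32) > eps p] for 30% of
    the [y].  So for every [S] more than 2/8 of the pairs [(x, y)] have
    [x + y] or [x - y] distorted, and averaging over [S] gives a
    contradiction. *)

Require Import Defs.
From mathcomp Require Import all_boot all_order all_algebra.
From mathcomp Require Import all_classical all_reals all_analysis.
From mathcomp Require Import measurable_realfun ring lra.
Set Implicit Arguments.
Unset Strict Implicit.
Unset Printing Implicit Defensive.
Import Order.TTheory GRing.Theory Num.Theory.
Import numFieldNormedType.Exports.
Local Open Scope ring_scope.

(** * Inner products and projection onto the row space *)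

Definition dot {R : realFieldType} {p : nat} (u v : 'cV[R]_p) : R :=
  \sum_(i < p) u i 0 * v i 0.

Definition sign_vector {R : realFieldType} {p : nat} (b : {ffun 'I_p -> bool}) :
    'cV[R]_p := \col_i (-1) ^+ b i.

Definition flip {p : nat} (k : 'I_p) (b : {ffun 'I_p -> bool}) :
  {ffun 'I_p -> bool} := [ffun i => b i (+) (i == k)].

Lemma dotE {R : realFieldType} {p : nat} (u v : 'cV[R]_p) :
  dot u v = (u^T *m v) 0 0.
Proof. by rewrite mxE; apply: eq_bigr => i _; rewrite mxE. Qed.

Lemma dot_mulmxr {R : realFieldType} {p m : nat} (A : 'M[R]_(p, m)) u
  (v : 'cV[R]_m) : dot u (A *m v) = dot (A^T *m u) v.
Proof. by rewrite !dotE trmx_mul trmxK mulmxA. Qed.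

Section DotProduct.
Variables (R : realFieldType) (p : nat).
Implicit Types (u v w : 'cV[R]_p) (Q : 'M[R]_p).

Lemma dotC u v : dot u v = dot v u.
Proof. by apply: eq_bigr => i _; rewrite mulrC. Qed.

Lemma dotDl u v w : dot (u + v) w = dot u w + dot v w.
Proof. by rewrite -big_split; apply: eq_bigr => i _; rewrite mxE mulrDl. Qed.

Lemma dotDr u v w : dot w (u + v) = dot w u + dot w v.
Proof. by rewrite dotC dotDl !(dotC w). Qed.

Lemma dotNl u v : dot (- u) v = - dot u v.
Proof. by rewrite -sumrN; apply: eq_bigr => i _; rewrite mxE mulNr. Qed.

Lemma dotNr u v : dot u (- v) = - dot u v.
Proof. by rewrite dotC dotNl dotC. Qed.

Lemma dot_ge0 u : 0 <= dot u u.
Proof. by apply: sumr_ge0 => i _; rewrite -expr2 sqr_ge0. Qed.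

Lemma dot_eq0 u : (dot u u == 0) = (u == 0).
Proof.
apply/eqP/eqP => [|->]; last by rewrite /dot big1// => i _; rewrite mxE mul0r.
move/psumr_eq0P => h; apply/colP => i; rewrite mxE; apply/eqP.
rewrite -sqrf_eq0 expr2; apply/eqP/h => // j _.
by rewrite -expr2 sqr_ge0.
Qed.

(* Adding the normalized Gram-Schmidt residual of a row to the projection
   raises the trace by one. *)
Lemma row_space_projection m (S : 'M[R]_(m, p)) :
  exists Q, [/\ Q^T = Q, Q *m Q = Q, S *m Q = S & \tr Q <= m%:R].
Proof.
suff H k : (k <= m)%N -> exists Q, [/\ Q^T = Q, Q *m Q = Q,
    forall i : 'I_m, (i < k)%N -> row i S *m Q = row i S & \tr Q <= k%:R].
  have [Q [QT QQ SQ tQ]] := H m (leqnn m).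
  exists Q; split => //; apply/row_matrixP => i.
  by rewrite row_mul SQ.
elim: k => [_|k IH lt_km].
  exists 0; split; rewrite ?trmx0 ?mulmx0 ?mxtrace0 //.
have [Q [QT QQ SQ tQ]] := IH (ltnW lt_km).
pose i0 := Ordinal lt_km; pose r := row i0 S - row i0 S *m Q.
have rQ : r *m Q = 0 by rewrite mulmxBl -mulmxA QQ subrr.
have Qr : Q *m r^T = 0 by rewrite -[Q]QT -trmx_mul rQ trmx0.
have Sr (i : 'I_m) : (i < k)%N -> row i S *m r^T = 0.
  by move=> ik; rewrite -(SQ i ik) -mulmxA Qr mulmx0.
have rr : r *m r^T = (dot r^T r^T)%:M.
  by rewrite [LHS]mx11_scalar dotE trmxK.
(* If [r = 0], the new row is already fixed by [Q], and the trace bound only loosens. *)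
have [r0|r_neq0] := eqVneq r 0.
  exists Q; split => //; last by rewrite (le_trans tQ)// ler_nat.
  move=> i; rewrite ltnS leq_eqVlt => /orP[/eqP ik|]; last exact: SQ.
  have -> : i = i0 by apply/val_inj.
  by apply/esym/eqP; rewrite -subr_eq0 -/r r0.
have D0 : dot r^T r^T != 0 by rewrite dot_eq0 trmx_eq0.
set D := dot r^T r^T in rr D0.
have rSr : row i0 S *m r^T = D%:M.
  by rewrite -rr /r [in RHS]mulmxBl -mulmxA Qr mulmx0 subr0.
exists (Q + D^-1 *: (r^T *m r)); split.
- by rewrite linearD /= linearZ /= trmx_mul trmxK QT.
- have rrr : r^T *m r *m (r^T *m r) = D *: (r^T *m r).
    by rewrite mulmxA -[r^T *m r *m r^T]mulmxA rr mul_mx_scalar scalemxAl.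
  have Qrr : Q *m (r^T *m r) = 0 by rewrite mulmxA Qr mul0mx.
  have rrQ : r^T *m r *m Q = 0 by rewrite -mulmxA rQ mulmx0.
  set X := r^T *m r in rrr Qrr rrQ *.
  rewrite mulmxDl !mulmxDr QQ -[Q *m (_ *: X)]scalemxAr Qrr scaler0 addr0.
  rewrite -scalemxAl rrQ scaler0 add0r -scalemxAr -scalemxAl rrr.
  by rewrite !scalerA -mulrA mulVf // mulr1.
- move=> i; rewrite ltnS leq_eqVlt mulmxDr -scalemxAr mulmxA.
  move=> /orP[/eqP ik|ik]; last by rewrite SQ// Sr// mul0mx scaler0 addr0.
  have -> : i = i0 by apply/val_inj.
  by rewrite rSr mul_scalar_mx scalerA mulVf// scale1r /r addrC subrK.
- rewrite mxtraceD mxtraceZ mxtrace_mulC rr mxtrace_scalar mulVf//.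
  by rewrite -natr1 lerD2r.
Qed.

Lemma dot_sub_projection Q u : Q^T = Q -> Q *m Q = Q ->
  dot (u - Q *m u) (u - Q *m u) = dot u u - dot u (Q *m u).
Proof.
move=> QT QQ; have QuQu : dot (Q *m u) (Q *m u) = dot u (Q *m u).
  by rewrite dot_mulmxr QT mulmxA QQ dotC.
rewrite dotDl !dotDr !dotNl !dotNr QuQu (dotC (Q *m u) u); ring.
Qed.

Lemma projection_form_ge0 Q u : Q^T = Q -> Q *m Q = Q -> 0 <= dot u (Q *m u).
Proof. by move=> QT QQ; rewrite -QQ -mulmxA dot_mulmxr QT dot_ge0. Qed.

(** Since [Q] fixes the range of [S^T], applying [1 - Q] to the residual leaves only [-(u - Q u)],
    and an orthogonal projection does not increase the norm. *)
Lemma residual_norm_ge m (S : 'M[R]_(m, p)) Q u :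
  Q^T = Q -> Q *m Q = Q -> S *m Q = S ->
  dot u u - dot u (Q *m u) <= dot (S^T *m (S *m u) - u) (S^T *m (S *m u) - u).
Proof.
move=> QT QQ SQ; set r := _ - u.
have QST : Q *m S^T = S^T by rewrite -{1}QT -trmx_mul SQ.
have rQ : r - Q *m r = - (u - Q *m u).
  by rewrite /r mulmxBr (mulmxA Q) QST !opprB addrC subrKA.
have := dot_sub_projection r QT QQ.
rewrite rQ dotNl dotNr opprK dot_sub_projection // => ->.
by rewrite gerBl projection_form_ge0.
Qed.

End DotProduct.

(** * Moments of uniform sign vectors *)

Section Signs.
Variables (R : realFieldType) (p : nat).
Implicit Types (b : {ffun 'I_p -> bool}) (v : 'cV[R]_p).

Let N : R := #|{ffun 'I_p -> bool}|%:R.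

Lemma flipK k : involutive (@flip p k).
Proof. by move=> b; apply/ffunP => i; rewrite !ffunE addbK. Qed.

Lemma sign_vector_flip k b i :
  @sign_vector R p (flip k b) i 0 = (-1) ^+ (i == k) * sign_vector b i 0.
Proof. by rewrite !mxE ffunE signr_addb mulrC. Qed.

Lemma sign_vector_sqr b i : @sign_vector R p b i 0 ^+ 2 = 1.
Proof. by rewrite mxE sqrr_sign. Qed.

Lemma dot_sign_vector b : dot (@sign_vector R p b) (sign_vector b) = p%:R.
Proof.
rewrite /dot (eq_bigr (fun=> 1)) ?sumr_const ?card_ord //.
by move=> i _; rewrite -expr2 sign_vector_sqr.
Qed.

Lemma sum_flip_odd k (f : {ffun 'I_p -> bool} -> R) :
  (forall b, f (flip k b) = - f b) -> \sum_b f b = 0.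
Proof.
move=> fN; have : \sum_b f b = - \sum_b f b.
  rewrite -sumrN [LHS](reindex_inj (inv_inj (flipK k))).
  by apply: eq_bigr => b _; rewrite fN.
lra.
Qed.

Lemma sum_sign_vector_pair i j :
  \sum_b @sign_vector R p b i 0 * sign_vector b j 0 = N * (i == j)%:R.
Proof.
have [->|ij] := eqVneq i j.
  rewrite (eq_bigr (fun=> 1)) ?sumr_const ?mulr1 // => b _.
  by rewrite -expr2 sign_vector_sqr.
rewrite mulr0; apply: (@sum_flip_odd i) => b.
by rewrite !sign_vector_flip eqxx eq_sym (negbTE ij) /= mul1r mulN1r mulNr.
Qed.

(** Off-diagonal entries of [Q] average out because distinct signs are uncorrelated. *)
Lemma sum_sign_vector_form (Q : 'M[R]_p) :
  \sum_b dot (@sign_vector R p b) (Q *m sign_vector b) = N * \tr Q.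
Proof.
transitivity (\sum_b \sum_i \sum_j
    Q i j * (@sign_vector R p b i 0 * sign_vector b j 0)).
  apply: eq_bigr => b _; apply: eq_bigr => i _.
  by rewrite [(Q *m _) i 0]mxE mulr_sumr; apply: eq_bigr => j _; rewrite mulrCA.
rewrite exchange_big mulr_sumr; apply: eq_bigr => i _ /=.
rewrite exchange_big /= (bigD1 i) //= -mulr_sumr sum_sign_vector_pair eqxx mulr1.
rewrite big1 ?addr0 1?mulrC // => j ji.
by rewrite -mulr_sumr sum_sign_vector_pair eq_sym (negbTE ji) !mulr0.
Qed.

(** Induction on the support: when a coordinate [k] is added, terms odd in its sign cancel under
    [flip k], and even powers of that sign are 1. *)
Lemma khintchine24_seq v (s : seq 'I_p) : uniq s ->
  let T b := \sum_(i <- s) v i 0 * sign_vector b i 0 in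
  let a := \sum_(i <- s) v i 0 ^+ 2 in
  \sum_b T b ^+ 2 = N * a /\ \sum_b T b ^+ 4 <= 3 * N * a ^+ 2.
Proof.
elim: s => [_|k s IH /= /andP[ks us]] /=.
  split; first by rewrite big1 ?big_nil ?mulr0 // => b _; rewrite big_nil expr0n.
  by rewrite big1 ?big_nil ?expr0n ?mulr0 //= => b _; rewrite big_nil expr0n.
have [] := IH us.
set T := fun b => \sum_(i <- s) v i 0 * sign_vector b i 0.
set a := \sum_(i <- s) v i 0 ^+ 2 => IH2 IH4.
have T_flip b : T (flip k b) = T b.
  apply: eq_big_seq => i si; rewrite sign_vector_flip.
  by rewrite (_ : i == k = false) ?mul1r //; apply: contraNF ks => /eqP <-.
have s_flip b : @sign_vector R p (flip k b) k 0 = - sign_vector b k 0.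
  by rewrite sign_vector_flip eqxx mulN1r.
pose e b : R := sign_vector b k 0.
have e2 b : e b ^+ 2 = 1 by exact: sign_vector_sqr.
set c := v k 0.
have eT x : \sum_b x * (e b * T b) = 0.
  by apply: (@sum_flip_odd k) => b; rewrite T_flip /e s_flip mulNr mulrN.
have eT3 x : \sum_b x * (e b * T b ^+ 3) = 0.
  by apply: (@sum_flip_odd k) => b; rewrite T_flip /e s_flip mulNr mulrN.
have cst x : \sum_(b : {ffun 'I_p -> bool}) x = N * x.
  by rewrite sumr_const mulr_natl.
have E2 : \sum_b (c * e b + T b) ^+ 2 = N * (c ^+ 2 + a).
  transitivity (\sum_b (c ^+ 2 + T b ^+ 2 + 2 * c * (e b * T b))).
    by apply: eq_bigr => b _; ring: (e2 b).
  by rewrite !big_split /= IH2 eT cst; ring.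
have E4 : \sum_b (c * e b + T b) ^+ 4 <= 3 * N * (c ^+ 2 + a) ^+ 2.
  rewrite (_ : \sum_b _ = \sum_b (c ^+ 4 + 6 * c ^+ 2 * T b ^+ 2 + T b ^+ 4
     + (4 * c ^+ 3 * (e b * T b) + 4 * c * (e b * T b ^+ 3)))); last first.
    by apply: eq_bigr => b _; ring: (e2 b).
  have T2 x : \sum_b x * T b ^+ 2 = x * (N * a) by rewrite -mulr_sumr IH2.
  rewrite !big_split /= eT eT3 T2 cst.
  (* The surviving terms [c^4 + 6 c^2 a + 3 a^2] equal [3 (c^2 + a)^2 - 2 c^4]. *)
  have : 0 <= N * c ^+ 4 by rewrite mulr_ge0 ?ler0n // exprn_even_ge0.
  move: IH4; set X := \sum_b _ ; nra.
split; last by under eq_bigr do rewrite big_cons; rewrite big_cons.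
by under eq_bigr do rewrite big_cons; rewrite big_cons.
Qed.

Lemma khintchine24 v :
  \sum_b dot v (sign_vector b) ^+ 2 = N * dot v v /\
  \sum_b dot v (sign_vector b) ^+ 4 <= 3 * N * dot v v ^+ 2.
Proof.
have -> : dot v v = \sum_i v i 0 ^+ 2 by apply: eq_bigr => i _; rewrite expr2.
by apply: khintchine24_seq; exact: index_enum_uniq.
Qed.

End Signs.

(* Paley-Zygmund: with [t = f x - a / 16], the indicator of [t >= 0] dominates
   the quadratic [1 - (1 - t / (3 a)) ^ 2]. *)
Lemma paley_zygmund {R : realFieldType} {T : finType} (f : T -> R) (a : R) :
  (forall x, 0 <= f x) -> 0 <= a -> \sum_x f x = #|T|%:R * a ->
  \sum_x f x ^+ 2 <= 3 * #|T|%:R * a ^+ 2 ->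
  3 / 10 * #|T|%:R <= \sum_x (a / 16 <= f x)%R%:R :> R.
Proof.
move=> f0; rewrite le_eqVlt => /predU1P[<- _ _|a0 m1 m2].
  rewrite (eq_bigr (fun=> 1)) => [|x _]; last by rewrite mul0r f0.
  have := ler0n R #|T|; rewrite sumr_const; lra.
have aa : 0 < a ^+ 2 by rewrite exprn_gt0.
rewrite -(ler_pM2l aa) [X in _ <= X]mulr_sumr.
apply: (@le_trans _ _ (\sum_x ((2 / 3) * a * (f x - a / 16)
    - (1 / 9) * (f x - a / 16) ^+ 2))); last first.
  apply: ler_sum => x _; set t := f x - a / 16.
  case: (leP (a / 16) (f x)) => h; last first.
    by have t0 : t < 0; [rewrite subr_lt0 | rewrite /= mulr0; nra].
  by have := sqr_ge0 (a - t / 3); rewrite /= mulr1; nra.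
rewrite (_ : \sum_x _ = \sum_x ((2 / 3 * a + a / 72) * f x
  - (1 / 9) * f x ^+ 2 - (a ^+ 2 / 24 + a ^+ 2 / 2304))); last first.
  by apply: eq_bigr => x _; field.
(* On average the quadratic is at least [a^2 (5/8 - 737/2304)], slightly above [3/10 a^2]. *)
rewrite !big_split /= sumrN -!mulr_sumr m1 sumr_const -mulr_natl.
have := ler0n R #|T|; move: m2; set X := \sum_x _; set n := #|T|%:R.
nra.
Qed.

(** * Distortion of sums and differences of sign vectors *)

Definition distorted {R : realFieldType} {m p : nat} (S : 'M[R]_(m, p))
    (eps : R) (x : 'cV[R]_p) : bool :=
  eps * dot x x < `|dot (S *m x) (S *m x) - dot x x|.

Section DistortedSigns.
Variables (R : realFieldType) (m p : nat) (S : 'M[R]_(m, p)).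
Implicit Types (x y : 'cV[R]_p) (b : {ffun 'I_p -> bool}) (eps : R).

Let N : R := #|{ffun 'I_p -> bool}|%:R.
Let residual x := S^T *m (S *m x) - x.

(** The errors at [x + y] and [x - y] differ by [4 <residual x, y>], while by the parallelogram law
    their tolerances add up to [2 eps (|x|^2 + |y|^2)]. *)
Lemma distorted_polarization eps x y :
  eps * (dot x x + dot y y) < 2 * `|dot (residual x) y| ->
  distorted S eps (x + y) || distorted S eps (x - y).
Proof.
rewrite /distorted !ltNge -negb_and; apply: contra => /andP[].
rewrite !mulmxDr mulmxN !(dotDl, dotDr, dotNl, dotNr) -dot_mulmxr.
rewrite (dotC y x) (dotC (S *m y) (S *m x)).
set sxx := dot (S *m x) (S *m x); set syy := dot (S *m y) (S *m y).
set sxy := dot (S *m x) (S *m y).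
rewrite !ler_norml => /andP[? ?] /andP[? ?].
have -> : 2 * `|sxy - dot x y| = `|2 * (sxy - dot x y)|.
  by rewrite normrM ger0_norm.
by rewrite ler_norml; apply/andP; split; lra.
Qed.

Lemma residual_sign_vector_large : (0 < p)%N -> 40 * m%:R <= p%:R :> R ->
  19 / 20 * N <=
    \sum_b (p%:R / 2 <= dot (residual (sign_vector b)) (residual (sign_vector b)))%R%:R.
Proof.
move=> p_gt0 mp; have p0 : 0 < p%:R :> R by rewrite ltr0n.
have [Q [QT QQ SQ tQ]] := row_space_projection S.
pose z b := dot (@sign_vector R p b) (Q *m sign_vector b).
(* Markov's inequality in pointwise form: [z] has mean [\tr Q <= m <= p / 40], so [z > p / 2] for at
   most 1/20 of the signs. *)
apply: (@le_trans _ _ (\sum_b (1 - 2 / p%:R * z b))).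
  rewrite big_split /= sumrN -mulr_sumr sum_sign_vector_form sumr_const -/N.
  have N0 : 0 <= N by exact: ler0n.
  have tp : 2 / p%:R * \tr Q <= 1 / 20.
    by rewrite mulrAC ler_pdivrMr //; lra.
  have := ler_wpM2l N0 tp; nra.
apply: ler_sum => b _; have z0 : 0 <= z b by exact: projection_form_ge0.
have h : p%:R - z b <= dot (residual (sign_vector b)) (residual (sign_vector b)).
  by rewrite -(dot_sign_vector R b); exact: residual_norm_ge.
have e : 2 / p%:R * z b = 2 * z b / p%:R by rewrite mulrAC.
case: (leP (p%:R / 2)) => /= h2; rewrite e.
  by rewrite gerBl mulr_ge0 ?invr_ge0 ?mulr_ge0 // ltW.
by rewrite subr_le0 ler_pdivlMr //; lra.
Qed.

(** The constant is [57/200 = 19/20 * 3/10]: the fraction of good [b] times the fraction of good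
    [b'] for each of them. *)
Lemma distorted_sign_vectors eps : (0 < p)%N -> 40 * m%:R <= p%:R :> R ->
  0 <= eps -> 32 * eps ^+ 2 * p%:R < 1 ->
  57 / 200 * N ^+ 2 <= \sum_b \sum_b'
    ((distorted S eps (sign_vector b + sign_vector b'))%:R
      + (distorted S eps (sign_vector b - sign_vector b'))%:R).
Proof.
move=> p_gt0 mp eps0 eps_p; have p0 : 0 < p%:R :> R by rewrite ltr0n.
pose L b := p%:R / 2 <= dot (residual (sign_vector b)) (residual (sign_vector b)).
have key b : 3 / 10 * N * (L b)%:R <= \sum_b'
    ((distorted S eps (sign_vector b + sign_vector b'))%:R
      + (distorted S eps (sign_vector b - sign_vector b'))%:R).
  case: (boolP (L b)) => [Lb|_]; last first.
    by rewrite mulr0 sumr_ge0// => b' _; rewrite addr_ge0.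
  rewrite mulr1; set v := residual (sign_vector b) in Lb.
  have [k2 k4] := khintchine24 v.
  apply: (le_trans (paley_zygmund (f := fun b' => dot v (sign_vector b') ^+ 2)
    (fun=> sqr_ge0 _) (dot_ge0 v) k2 _)).
    by under eq_bigr do rewrite -exprM.
  apply: ler_sum => b' _; case: (leP (dot v v / 16)) => h; last by rewrite addr_ge0.
  have : distorted S eps (sign_vector b + sign_vector b') ||
         distorted S eps (sign_vector b - sign_vector b').
    apply: distorted_polarization; rewrite !dot_sign_vector -/v.
    have -> : eps * (p%:R + p%:R) = 2 * (eps * p%:R) by ring.
    rewrite ltr_pM2l //.
    (* After squaring: [<v, b'>^2 >= |v|^2 / 16 >= p / 32 > (eps p)^2]. *)
    rewrite -[ltLHS]ger0_norm ?mulr_ge0 // ?ltW // -ltr_sqr ?nnegrE //.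
    rewrite !real_normK ?num_real // exprMn.
    have : 32 * eps ^+ 2 * p%:R * p%:R < 1 * p%:R by rewrite ltr_pM2r.
    rewrite /L in Lb; lra.
  by case/orP => ->; rewrite ?lerDl ?lerDr.
apply: (le_trans _ (ler_sum _ (fun b _ => key b))).
rewrite -mulr_sumr; have := residual_sign_vector_large p_gt0 mp.
have : 0 <= N by exact: ler0n.
rewrite /L; set X := \sum_b _; nra.
Qed.

End DistortedSigns.

(** * From the AMM property to single vectors *)

(** First-moment method: the expected number of bad events is at most [q #|I|], so the count cannot
    be at least [q' #|I|] everywhere. *)
Lemma exists_few_bad {R : realType} {disp : measure_display}
    {T : measurableType disp} (P : probability T R) (I : finType)
    (B : I -> set T) (q q' : R) :
  (0 < #|I|)%N -> 0 <= q' -> q < q' ->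
  (forall i, measurable (B i)) -> (forall i, (P (B i) <= q%:E)%E) ->
  exists t, \sum_i \1_(B i) t < q' * #|I|%:R.
Proof.
move=> I0 q'0 qq' mB PB; apply: contrapT => /forallNP noT.
have f_ge t : q' * #|I|%:R <= \sum_i \1_(B i) t :> R.
  by rewrite leNgt; apply/negP/noT.
have m1 i : measurable_fun setT (EFin \o (\1_(B i) : T -> R)).
  by apply/measurable_EFinP; exact: measurable_indic.
have : ((q' * #|I|%:R)%:E <= \int[P]_t \sum_i (\1_(B i) t : R)%:E)%E.
  rewrite -[leLHS]mule1 -(@probability_setT _ _ _ P) -integral_cst //.
  apply: ge0_le_integral => //.
  - by move=> t _; rewrite lee_fin mulr_ge0.
  - exact: emeasurable_sum.
  - by move=> t _; rewrite sumEFin lee_fin.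
rewrite ge0_integral_sum //.
apply/negP; rewrite -ltNge.
apply: (@le_lt_trans _ _ (\sum_(i : I) q%:E)%E).
  by apply: lee_sum => i _; rewrite integral_indic // setIT; exact: PB.
by rewrite sumEFin lte_fin sumr_const -[q *+ _]mulr_natr ltr_pM2r ?ltr0n.
Qed.

(** The strict inequality makes the event open, as the preimage of an open ray under a continuous
    function of [S]. *)
Lemma measurable_distorted (R : realType) m d (eps : R) (v : 'cV[R]_d) :
  measurable ([set S : 'M[R]_(m, d) | distorted S eps v] : set (borel_matrix R m d)).
Proof.
apply: sub_sigma_algebra.
pose f (S : 'M[R]_(m, d)) := `|dot (S *m v) (S *m v) - dot v v|.
rewrite (_ : [set S | _]%classic = (f @^-1` [set z | eps * dot v v < z])%classic) //.
apply: open_comp; last exact: open_gt.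
move=> S _; have c i : ((S' *m v) i 0 @[S' --> S] --> (S *m v) i 0)%classic.
  rewrite mxE; under eq_fun do rewrite mxE.
  apply: (cvg_big add_continuous (nbhs_filter S)) => j _.
  by apply: cvgM; [exact: coord_continuous | exact: cvg_cst].
have cc : (dot (S' *m v) (S' *m v) @[S' --> S] --> dot (S *m v) (S *m v))%classic.
  apply: (cvg_big add_continuous (nbhs_filter S)) => i _.
  exact: cvgM.
exact: (cvg_norm (cvgB cc (cvg_cst _))).
Qed.

Lemma sqr_frobenius_norm (R : realType) m n (A : 'M[R]_(m, n)) :
  frobenius_norm A ^+ 2 = \sum_i \sum_j A i j ^+ 2.
Proof.
by rewrite sqr_sqrtr// sumr_ge0// => i _; rewrite sumr_ge0// => j _; rewrite sqr_ge0.
Qed.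

Lemma frobenius_norm_single_column (R : realType) d n (v : 'cV[R]_d) :
  frobenius_norm (v *m (delta_mx 0 0 : 'rV[R]_n.+1)) ^+ 2 = dot v v.
Proof.
rewrite sqr_frobenius_norm; apply: eq_bigr => i _.
rewrite (bigD1 0) //= big1 ?addr0 => [|j j0].
  by rewrite !mxE big_ord1 !mxE !eqxx mulr1 expr2.
by rewrite !mxE big_ord1 !mxE (negbTE j0) andbF mulr0 expr0n.
Qed.

Lemma frobenius_norm_single_column_gram (R : realType) m d n
    (S : 'M[R]_(m, d)) (v : 'cV[R]_d) :
  let A := v *m (delta_mx 0 0 : 'rV[R]_n.+1) in
  frobenius_norm (A^T *m S^T *m S *m A - A^T *m A) =
  `|dot (S *m v) (S *m v) - dot v v|.
Proof.
set e := delta_mx 0 0 => A; set t := dot _ _ - _.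
rewrite -[LHS]ger0_norm ?sqrtr_ge0 // -sqrtr_sqr.
(* The error matrix has a single possibly nonzero entry [t], so it is again one column padded by
   zeros. *)
have -> : A^T *m S^T *m S *m A - A^T *m A = (t *: e^T) *m e.
  have -> : t *: e^T = e^T *m t%:M by rewrite mul_mx_scalar.
  have -> : A^T *m S^T *m S *m A = e^T *m (v^T *m S^T *m S *m v) *m e.
    by rewrite /A trmx_mul !mulmxA.
  have -> : A^T *m A = e^T *m (v^T *m v) *m e by rewrite /A trmx_mul !mulmxA.
  rewrite -mulmxBl -mulmxBr; congr (_ *m _ *m _).
  by rewrite [LHS]mx11_scalar /t !dotE trmx_mul !mulmxA !mxE.
rewrite frobenius_norm_single_column -sqrtr_sqr; congr Num.sqrt.
rewrite /dot (bigD1 0) //= big1 ?addr0 => [|j j0].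
  by rewrite !mxE !eqxx mulr1 expr2.
by rewrite !mxE (negbTE j0) andbF mulr0 mul0r.
Qed.

Lemma AMM_distorted (R : realType) m d n (eps : R)
    (P : probability (borel_matrix R m d) R) (v : 'cV[R]_d) :
  (0 < n)%N -> AMM n eps P ->
  (P [set S : 'M[R]_(m, d) | distorted S eps v]%classic <= (1 / 10)%:E)%E.
Proof.
case: n => // n _ /(_ (v *m delta_mx 0 0)).
rewrite (_ : [set S | _]%classic =
    (~` [set S : 'M[R]_(m, d) | distorted S eps v])%classic); last first.
  apply/seteqP; split => S /=;
    rewrite /distorted frobenius_norm_single_column
      frobenius_norm_single_column_gram.
    by move=> ?; apply/negP; rewrite -leNgt.
  by move/negP; rewrite -leNgt.
rewrite probability_setC; last exact: measurable_distorted.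
have /fineK <- := fin_num_measure P _ (@measurable_distorted R m d eps v).
rewrite -EFinB !lee_fin; lra.
Qed.

(** This passes from [d] coordinates to [p] by replacing [S] with [S *m E]. *)
Lemma distorted_isometry {R : realFieldType} m d p (S : 'M[R]_(m, d))
    (E : 'M[R]_(d, p)) (eps : R) (x : 'cV[R]_p) :
  E^T *m E = 1%:M -> distorted S eps (E *m x) = distorted (S *m E) eps x.
Proof.
move=> EE; rewrite /distorted !mulmxA.
suff -> : dot (E *m x) (E *m x) = dot x x by [].
by rewrite dot_mulmxr mulmxA EE mul1mx.
Qed.

(** * The lower bound on the number of rows *)

Lemma AMM_dimension_lower_bound (R : realType) m d n p (eps : R)
    (P : probability (borel_matrix R m d) R) :
  (0 < n)%N -> (0 < p <= d)%N -> 0 <= eps -> 32 * eps ^+ 2 * p%:R < 1 ->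
  AMM n eps P -> p%:R < 40 * m%:R :> R.
Proof.
move=> n0 /andP[p0 pd] eps0 eps_p amm; rewrite ltNge; apply/negP => mp.
(* [E] embeds the first [p] coordinates; its columns are orthonormal because [p <= d]. *)
pose E : 'M[R]_(d, p) := pid_mx p.
have EE : E^T *m E = 1%:M.
  by rewrite /E tr_pid_mx mul_pid_mx minnn (minn_idPr pd) pid_mx_1.
pose F := {ffun 'I_p -> bool}.
pose w (i : bool * (F * F)) : 'cV[R]_p :=
  sign_vector i.2.1 + (-1) ^+ i.1 *: sign_vector i.2.2.
pose B i : set (borel_matrix R m d) := [set S | distorted S eps (E *m w i)]%classic.
(* Any threshold above the failure rate [1/10] and at most [57/400] works: of the [2 N^2] test
   vectors, with [N] the number of sign patterns, at least [57/200 N^2] are distorted. *)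
have [||||| S] := @exists_few_bad R _ _ P _ B (1 / 10) (1 / 8).
- by apply/card_gt0P; exists (true, ([ffun=> true], [ffun=> true])).
- by [].
- lra.
- by move=> i; exact: measurable_distorted.
- by move=> i; exact: AMM_distorted amm.
apply/negP; rewrite -leNgt.
have -> : \sum_i \1_(B i) S = \sum_i (distorted (S *m E) eps (w i))%:R :> R.
  by apply: eq_bigr => i _; rewrite indicE -distorted_isometry // /B mem_setE.
rewrite -(pair_bigA _ (fun a (c : F * F) => (distorted (S *m E) eps (w (a, c)))%:R)).
rewrite exchange_big -(pair_bigA _ (fun b b' => \sum_a
  (distorted (S *m E) eps (w (a, (b, b'))))%:R)) /=.
have := distorted_sign_vectors (S *m E) p0 mp eps0 eps_p.
rewrite !card_prod card_bool !natrM -expr2.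
under [X in _ <= X -> _]eq_bigr => b _.
  under eq_bigr => b' _.
    have <- : \sum_a (distorted (S *m E) eps (w (a, (b, b'))))%:R =
        (distorted (S *m E) eps (sign_vector b + sign_vector b'))%:R +
        (distorted (S *m E) eps (sign_vector b - sign_vector b'))%:R :> R.
      by rewrite big_bool /w /= expr1 expr0 scale1r scaleN1r addrC.
    over.
  over.
apply: le_trans.
have := sqr_ge0 (#|F|%:R : R); rewrite /F; lra.
Qed.

Theorem mainTheorem11 (R : realType) :
  exists c C D : R, [/\ 0 < c, 0 < C, 0 < D &
    forall (n : nat) (eps : R) (d m : nat)
      (P : probability (borel_matrix R m d) R),
      (0 < n)%N ->
      0 < eps -> eps < c / Num.sqrt n%:R ->
      D / eps ^+ 2 <= d%:R ->
      AMM n eps P ->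
      C / eps ^+ 2 <= m%:R].
Proof.
(* With [p] the integer part of [1 / (64 eps^2)]: [c = 1/8] ensures [p >= 1], [D = 1/64] ensures
   [p <= d], and [32 eps^2 p <= 1/2]. Finally [C = 1 / (40 * 128)], where 128 accounts for the
   rounding. *)
exists (1 / 8), (1 / 5120), (1 / 64); split; [lra|lra|lra|].
move=> n eps d m P n0 eps0 eps_lt d_ge amm.
have eps8 : eps < 1 / 8.
  apply: (lt_le_trans eps_lt); rewrite ler_pdivrMr ?sqrtr_gt0 ?ltr0n //.
  by rewrite ler_peMr // -[leLHS]sqrtr1 ler_wsqrtr // ler1n.
have e0 : 0 < eps ^+ 2 by rewrite exprn_gt0.
have e1 : 1 <= 1 / 64 / eps ^+ 2.
  by rewrite ler_pdivlMr // mul1r; nra.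
have := truncn_itv (le_trans ler01 e1); set p := Num.trunc _.
move=> /andP[p_le p_gt].
have p0 : (0 < p)%N by rewrite truncn_gt0.
have pd : (p <= d)%N by rewrite -(ler_nat R) (le_trans p_le).
have := @AMM_dimension_lower_bound R m d n p eps P n0 _ (ltW eps0) _ amm.
rewrite p0 pd /= => /(_ isT) H.
have p1 : 1 <= p%:R :> R by rewrite ler1n.
have {}p_le : p%:R * eps ^+ 2 <= 1 / 64 by rewrite -ler_pdivlMr.
have {}p_gt : 1 / 64 < (p%:R + 1) * eps ^+ 2 by rewrite -ltr_pdivrMr // natr1.
rewrite ler_pdivrMr //.
have {}H : p%:R < 40 * m%:R :> R by apply: H; lra.
(* As [p >= 1], [p + 1 <= 2 p], so [p > 1 / (128 eps^2)], to be combined with [p < 40 m]. *)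
nra.
Qed.
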